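(* Let $k\ge 1$, let $0<r_1<\cdots<r_k$ be integers, let $d=\gcd(r_1,\ldots,r_k)$, and for each positive integer $n$ let $M_n=\langle n,n+r_1,\ldots,n+r_k\rangle$. For $n>r_k^2$ the function $n\mapsto F(M_n)$ is $r_k$-quasiquadratic in $n$; that is, there exist functions $a_0,a_1,a_2:\mathbb Z\to\mathbb R$, each periodic with period dividing $r_k$, with $a_2$ not identically zero on the integers coprime to $d$, such that $$F(M_n)=a_2(n)n^2+a_1(n)n+a_0(n)$$ for all integers $n>r_k^2$ with $\gcd(n,d)=1$.
   Context: $\langle g_1,\ldots,g_m\rangle$ denotes the additive submonoid of $\mathbb Z_{\ge0}$ generated by $g_1,\ldots,g_m$. For an additive submonoid $M\subsetneq\mathbb Z_{\ge0}$ with $\gcd(M)=1$, the Frobenius number is $F(M)=\max(\mathbb Z_{\ge0}\setminus M)$. (When $\gcd(n,d)=1$ one has $\gcd(M_n)=1$.) *)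

(* Defs.v *)
From mathcomp Require Import all_boot all_order all_algebra.
From mathcomp Require Import boolp classical_sets reals.

Set Implicit Arguments.
Unset Strict Implicit.
Unset Printing Implicit Defensive.

Local Open Scope classical_set_scope.
Local Open Scope nat_scope.

Definition is_submonoid (M : set nat) : Prop :=
  M 0 /\ forall x y, M x -> M y -> M (x + y).

Definition submonoid_gen (gs : seq nat) : set nat :=
  smallest is_submonoid [set` gs].

(* gcd(M) = 1: the only common divisor of the elements of M is 1. *)
Definition gcd1_set (M : set nat) : Prop :=
  forall e, (forall x, M x -> e %| x) -> e = 1.

(* f is the greatest element of the complement of M. *)
Definition is_frobenius (M : set nat) (f : nat) : Prop :=
  (~` M) f /\ forall x, (~` M) x -> x <= f.

(* The value is 0 when the complement of M has no greatest element;
   see frobeniusP. *)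
Definition frobenius (M : set nat) : nat := xget 0 (is_frobenius M).

(* The sequence r is indexed from 1: only r 1, ..., r k are used. *)
Definition shifted_gens (k : nat) (r : nat -> nat) (n : nat) : seq nat :=
  n :: [seq n + r i | i <- iota 1 k].

Definition shifted_monoid (k : nat) (r : nat -> nat) (n : nat) : set nat :=
  submonoid_gen (shifted_gens k r n).

Definition periodic_dvd (T : Type) (N : nat) (a : int -> T) : Prop :=
  exists p : nat, [/\ 0 < p, p %| N & forall x : int, a (x + p%:Z)%R = a x].

Lemma submonoidM (M : set nat) q x : is_submonoid M -> M x -> M (q * x).
Proof.
move=> [M0 MD] Mx; elim: q => [//|q IHq]; rewrite mulSn; exact: MD.
Qed.

Lemma submonoid_cofinite (M : set nat) :
  is_submonoid M -> gcd1_set M -> exists B, forall x, B <= x -> M x.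
Proof.
move=> sM gM; have [M0 MD] := sM.
pose P e := `[< 0 < e /\ exists a, M a /\ M (a + e) >].
have exP : exists e, P e.
  apply: contrapT => nP; suff: 2 = 1 by [].
  apply: gM => -[//|x] Mx; exfalso; apply: nP; exists x.+1.
  by apply/asboolP; split=> //; exists 0.
case: (ex_minnP exP) => e /asboolP[e0 [a [Ma Mae]]] emin.
have e1 : e = 1.
  apply: gM => x Mx; rewrite /dvdn -leqn0 leqNgt; apply/negP => r0.
  have : P (x %% e).
    apply/asboolP; split=> //; exists (x %/ e * (a + e)).
    split; first exact: submonoidM.
    rewrite mulnDr -addnA -divn_eq; apply: MD => //; exact: submonoidM.
  by move/emin; rewrite leqNgt ltn_mod e0.
rewrite {}e1 in Mae; exists (a * a) => x.
have [a0 _|a0 ax] := posnP a.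
  by rewrite -[x]muln1; apply: submonoidM => //; rewrite a0 in Mae.
have rq : x %% a <= x %/ a.
  by apply: (leq_trans (ltnW (ltn_pmod x a0))); rewrite leq_divRL.
have -> : x = (x %/ a - x %% a) * a + x %% a * (a + 1).
  by rewrite mulnDr muln1 addnA -mulnDl subnK // -divn_eq.
by apply: MD; apply: submonoidM.
Qed.

Lemma frobeniusP (M : set nat) :
  is_submonoid M -> gcd1_set M -> M <> setT -> is_frobenius M (frobenius M).
Proof.
move=> sM gM pM; have [B MB] := submonoid_cofinite sM gM.
apply: xgetPex; pose P x := `[< (~` M) x >].
have exP : exists x, P x.
  apply: contrapT => nP; apply: pM; apply/seteqP; split=> // x _.
  by apply: contrapT => nMx; apply: nP; exists x; apply/asboolP.
have ubP x : P x -> x <= B.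
  by move=> /asboolP nMx; rewrite leqNgt; apply/negP => /ltnW /MB.
case: (ex_maxnP exP ubP) => f /asboolP nMf fmax.
by exists f; split=> // x nMx; apply: fmax; apply/asboolP.
Qed.

Lemma is_frobenius_eq (M : set nat) f : is_frobenius M f -> frobenius M = f.
Proof.
move=> Mf; apply: xget_unique => // g [nMg gmax].
by case: Mf => nMf fmax; apply/eqP; rewrite eqn_leq fmax // gmax.
Qed.

Lemma submonoid_genP (gs : seq nat) : is_submonoid (submonoid_gen gs).
Proof.
split=> [A [[A0 _] _] //|x y Mx My A AP].
by have [[_ AD] _] := AP; apply: AD; [exact: Mx|exact: My].
Qed.

Lemma shifted_monoid_gcd1 k r n :
  coprime n (\big[gcdn/0]_(1 <= i < k.+1) r i) -> gcd1_set (shifted_monoid k r n).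
Proof.
move=> /eqP cop e eM; apply/eqP; rewrite -dvdn1 -cop dvdn_gcd.
have eg g : g \in shifted_gens k r n -> e %| g.
  by move=> gP; apply: eM => A [_]; exact.
have en : e %| n by apply: eg; rewrite mem_head.
rewrite en big_seq_cond /=; apply: (big_ind (fun m => e %| m)) => //.
  by move=> x y ex ey; rewrite dvdn_gcd ex.
move=> i; rewrite andbT mem_index_iota => ik.
have := eg (n + r i); rewrite dvdn_addr //; apply.
by rewrite inE; apply/orP; right; apply/mapP; exists i; rewrite // mem_iota add1n.
Qed.

Lemma shifted_monoid_proper k r n : 1 < n -> shifted_monoid k r n <> setT.
Proof.
move=> n1 MT; have : shifted_monoid k r n 1 by rewrite MT.
move/(_ [set x | x = 0 \/ n <= x]) => /=.
case=> [|//|n_le1]; last by rewrite leqNgt n1 in n_le1.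
split; first split; first by left.
  move=> x y [->//|nx] _; right; exact: (leq_trans nx (leq_addr _ _)).
move=> g /=; rewrite inE => /orP[/eqP->|/mapP[i _ ->]]; right => //.
exact: leq_addr.
Qed.

(* Main.v *)
Require Import Defs.
From mathcomp Require Import all_boot all_order all_algebra.
From mathcomp Require Import boolp classical_sets reals.
From mathcomp Require Import zify ring.

Set Implicit Arguments.
Unset Strict Implicit.
Unset Printing Implicit Defensive.

Import GRing.Theory Num.Theory.
Local Open Scope nat_scope.

(* Let S be the monoid generated by the r_i, R = r_k, and len x the least number
   of generators with sum x. An element of M_n has the form N n + x with x in S
   and len x <= N. For n > R^2 every multiple of d that is at least d n - R lies
   in S, and F(M_n) + n is the maximum of len z * n + z over the z = d n - R + u
   with u in a finite set that does not depend on n.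

   The key fact is that len (x + R) = len x + 1 as soon as len x >= R. It follows
   from the structure theorem for sumsets of Granville, Shakan and Walker: if
   m + 1 >= R, if x is a sum of generators, and if m R - x is a sum of the
   complements R - r_i and R, then x is a sum of at most m generators.
   Hence len z grows by exactly d t when n grows by t R, which makes F(M_n)
   quadratic on residue classes mod R, with leading coefficient d / R. *)

(** * Multisets and their weighted sums *)

(* A finite multiset of elements of I is encoded by its multiplicity function. *)
Definition wsum (I : finType) (w P : I -> nat) : nat := \sum_i P i * w i.

Notation mass := (wsum (fun=> 1)).

Definition subm (I : finType) (P Q : I -> nat) : Prop := forall i, P i <= Q i.

Lemma wsumD (I : finType) (w P Q : I -> nat) :
  wsum w (fun i => P i + Q i) = wsum w P + wsum w Q.
Proof. by rewrite -big_split; apply: eq_bigr => i _; rewrite mulnDl. Qed.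

Lemma wsumMl (I : finType) (w P : I -> nat) c :
  wsum w (fun i => c * P i) = c * wsum w P.
Proof. by rewrite big_distrr; apply: eq_bigr => i _; rewrite /= mulnA. Qed.

Lemma wsum_le (I : finType) (w P Q : I -> nat) : subm P Q -> wsum w P <= wsum w Q.
Proof. by move=> PQ; apply: leq_sum => i _; rewrite leq_mul2r PQ orbT. Qed.

Lemma wsum_ext (I : finType) (w P Q : I -> nat) : P =1 Q -> wsum w P = wsum w Q.
Proof. by move=> PQ; apply: eq_bigr => i _; rewrite PQ. Qed.

Lemma wsumB (I : finType) (w P Q : I -> nat) :
  subm Q P -> wsum w P = wsum w (fun i => P i - Q i) + wsum w Q.
Proof. by move=> QP; rewrite -wsumD; apply: wsum_ext => i; rewrite subnK. Qed.

Lemma wsum0 (I : finType) (w : I -> nat) : wsum w (fun=> 0) = 0.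
Proof. by rewrite /wsum big1. Qed.

Lemma wsum1 (I : finType) (w : I -> nat) a : wsum w (fun i => (i == a : nat)) = w a.
Proof.
rewrite /wsum (bigD1 a) //= eqxx mul1n big1 ?addn0 // => i /negbTE -> .
by rewrite mul0n.
Qed.

Lemma mass_lt (I : finType) (P Q : I -> nat) a :
  subm P Q -> P a < Q a -> mass P < mass Q.
Proof.
move=> PQ aPQ; rewrite /wsum (bigD1 a) //= [ltnRHS](bigD1 a) //= !muln1 -addSn.
by apply: leq_add => //; apply: leq_sum => i _; rewrite !muln1.
Qed.

Lemma mass_lt_ex (I : finType) (P Q : I -> nat) :
  mass P < mass Q -> exists i, P i < Q i.
Proof.
move=> PQ; apply: contrapT => nPQ; move: PQ; rewrite ltnNge => /negP; apply.
apply: wsum_le => i; rewrite leqNgt; apply/negP => lt; apply: nPQ; by exists i.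
Qed.

(** Converts a bound on the number of elements into one on the sum of the complements [R - w i], the
    form used in the structure theorem. *)
Lemma wsum_compl (I : finType) (R : nat) (w P : I -> nat) :
  (forall i, w i <= R) ->
  wsum w P + wsum (fun i => R - w i) P = mass P * R.
Proof.
move=> wR; rewrite -big_split big_distrl; apply: eq_bigr => i _ /=.
by rewrite -mulnDr subnKC // muln1.
Qed.

Lemma pigeonhole_mod (f : nat -> nat) (R L : nat) :
  0 < R -> R < L -> exists i j, [/\ i < j, j < L & f i = f j %[mod R]].
Proof.
move=> R0 RL; pose g (i : 'I_L) : 'I_R := Ordinal (ltn_pmod (f i) R0).
have /injectivePn[i [j ij gij]] : ~~ injectiveb g.
  by apply/injectiveP => /leq_card; rewrite !card_ord leqNgt RL.
have fij : f i = f j %[mod R] by case: gij.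
have [lt|gt|/val_inj e] := ltngtP i j; last by rewrite e eqxx in ij.
- by exists i, j.
- by exists j, i.
Qed.

(** [V] adds to [U] one missing element of [Q] at a time and is constant once it reaches [Q]. Its
    terms are the prefixes fed to the pigeonhole principle. *)
Lemma subm_chain (I : finType) (U Q : I -> nat) : subm U Q ->
  exists V : nat -> I -> nat,
    [/\ forall i j, i <= j -> subm (V i) (V j), forall j, subm U (V j),
        forall j, subm (V j) Q &
        forall j, mass U + j <= mass Q -> mass (V j) = mass U + j].
Proof.
move=> UQ.
pose step (V : I -> nat) : I -> nat :=
  if [pick i | V i < Q i] is Some a then fun i => V i + (i == a) else V.
have step_ge V : subm V (step V).
  by move=> i; rewrite /step; case: pickP => // a _; apply: leq_addr.
have step_le V : subm V Q -> subm (step V) Q.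
  move=> VQ i; rewrite /step; case: pickP => // a ltVQ.
  by case: eqP => [->|_]; rewrite ?addn1 ?addn0.
have step_mass V : mass V < mass Q -> mass (step V) = mass V + 1.
  move=> VQ; rewrite /step; case: pickP => [a _|no]; first by rewrite wsumD wsum1.
  by have [i] := mass_lt_ex VQ; rewrite no.
have mono i j : i <= j -> subm (iter i step U) (iter j step U).
  move=> /subnK <- a; elim: (j - i) => //= n IH; exact: leq_trans IH (step_ge _ _).
exists (fun j => iter j step U); split=> //.
- by move=> j; apply: (mono 0).
- by elim=> //= j IH; apply: step_le.
- elim=> [|j IH] le; first by rewrite addn0.
  rewrite iterS step_mass IH ?addnS ?addn1 //; lia.
Qed.

(** * Zero-sum free multisets modulo R *)

Definition zsfree (I : finType) (R : nat) (w P : I -> nat) : Prop :=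
  forall Z : I -> nat, subm Z P -> R %| wsum w Z -> mass Z = 0.

(** [V - U] is a zero-sum part of [P], hence empty. *)
Lemma zsfree_eqmod (I : finType) (R : nat) (w P U V : I -> nat) :
  zsfree R w P -> subm U V -> subm V P -> wsum w U = wsum w V %[mod R] ->
  mass U = mass V.
Proof.
move=> zP UV VP eUV.
have Z0 : mass (fun i => V i - U i) = 0.
  apply: zP => [i|]; first exact: leq_trans (leq_subr _ _) (VP i).
  move/eqP: eUV; rewrite [wsum w V](wsumB _ UV) -{1}[wsum w U]add0n eqn_modDr.
  by rewrite mod0n eq_sym.
by rewrite (wsumB _ UV) Z0.
Qed.

(** This is the Davenport constant of Z/R: among the [mass P + 1] prefix sums two would agree mod R,
    and the elements between them would form a zero-sum part. *)
Lemma zsfree_mass (I : finType) (R : nat) (w P : I -> nat) :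
  0 < R -> zsfree R w P -> mass P < R.
Proof.
move=> R0 zP; rewrite ltnNge; apply/negP => RP.
have [//|V [Vmono _ VP Vm]] := @subm_chain I (fun=> 0) P; rewrite wsum0 in Vm.
have [i [j [ij jP e]]] :=
  @pigeonhole_mod (fun j => wsum w (V j)) R (mass P).+1 R0 RP.
have := zsfree_eqmod zP (Vmono _ _ (ltnW ij)) (VP _) e.
rewrite !Vm; lia.
Qed.

(** Deleting nonempty zero-sum parts until none is left preserves the sum mod R. *)
Lemma zsfree_reduce (I : finType) (R : nat) (w P : I -> nat) :
  exists Q, [/\ subm Q P, zsfree R w Q & wsum w Q = wsum w P %[mod R]].
Proof.
have [n] := ubnP (mass P); elim: n P => // n IH P Pn.
have [zP|/existsNP[Z /not_implyP[ZP /not_implyP[RZ Z0]]]] := pselect (zsfree R w P).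
  by exists P; split=> // i.
have mP := wsumB (fun=> 1) ZP; have wP := wsumB w ZP.
have [|Q [QP zQ eQ]] := IH (fun i => P i - Z i); first by lia.
exists Q; split=> // [i|]; first exact: leq_trans (QP i) (leq_subr _ _).
by rewrite eQ wP -modnDmr (eqP RZ) addn0.
Qed.

(** * The structure theorem for sumsets *)

Lemma eqmod_lt (R a b : nat) : a = b %[mod R] -> a < b -> a + R <= b.
Proof.
move=> e ab; have : R %| b - a.
  by rewrite -eqn_mod_dvd; [apply/eqP|exact: ltnW].
rewrite -leq_subRL ?(ltnW ab) //; apply: dvdn_leq; by rewrite subn_gt0.
Qed.

(* Take such a pair P, Q with [mass (max P Q)] minimal; comparing sums, this mass
   exceeds R. List Q one element at a time, starting with some a in Q \ P, and list
   P \ Q likewise. As P and Q are zero-sum free, the pigeonhole principle provides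
   a nonempty prefix V of Q and a proper prefix W of P \ Q with the same sum mod R.
   Replacing V by W in Q and dropping zero-sum parts gives Q3, and (P, Q3) or
   (Q3, Q) is again such a pair, with a smaller union. *)
Lemma no_bad_pair (I : finType) (R : nat) (w : I -> nat) (x y m : nat)
    (P Q : I -> nat) :
  0 < R -> (forall i, w i <= R) -> R <= m.+1 -> x + y = m * R ->
  (forall T, wsum w T = x %[mod R] ->
     (x < wsum w T) \/ (y < wsum (fun i => R - w i) T)) ->
  zsfree R w P -> zsfree R w Q ->
  wsum w P = x %[mod R] -> wsum w Q = x %[mod R] ->
  y < wsum (fun i => R - w i) P -> x < wsum w Q -> False.
Proof.
move=> R0 wR Rm xy nogood; set D := wsum (fun i => R - w i).
have [n] := ubnP (mass (fun i => maxn (P i) (Q i))).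
elim: n P Q => // n IH P Q Ln zP zQ eP eQ yP xQ.
set U := fun i => maxn (P i) (Q i).
have UP : subm P U by move=> i; apply: leq_maxl.
have UQ : subm Q U by move=> i; apply: leq_maxr.
(* By congruence each of the strict inequalities [yP] and [xQ] gains a full R, so the two sums over
   [U] total at least (m + 2) R. *)
have mL : m.+2 <= mass U.
  have yDP : y = D P %[mod R].
    apply/eqP; rewrite -(eqn_modDl (wsum w P)) (wsum_compl _ wR) -modnDml eP.
    by rewrite modnDml xy !modnMl.
  rewrite -(leq_pmul2r R0) !mulSn -xy.
  have := eqmod_lt yDP yP; have := eqmod_lt (esym eQ) xQ.
  have := wsum_le w UQ; have := wsum_le (fun i => R - w i) UP.
  by have := wsum_compl U wR; rewrite -/D; clear; lia.
have mP := zsfree_mass R0 zP; have mQ := zsfree_mass R0 zQ.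
pose P1 i := P i - Q i.
have UE i : U i = P1 i + Q i by rewrite /U /P1; lia.
have mU : mass U = mass P1 + mass Q by rewrite -wsumD; apply: wsum_ext.
have P1P : subm P1 P by move=> i; apply: leq_subr.
have [a aPQ] : exists a, P a < Q a.
  have [|a] := @mass_lt_ex _ P U; first by lia.
  by rewrite /U => ?; exists a; lia.
have [//|W [Wmono _ WP1 Wm]] := @subm_chain I (fun=> 0) P1; rewrite wsum0 in Wm.
have [|V [Vmono Va VQ Vm]] := @subm_chain I (fun i => (i == a : nat)) Q.
  by move=> i; case: eqP => // ->; lia.
rewrite wsum1 in Vm.
(* The first [mass P1] indices give the proper prefixes of P \ Q, the others prefixes of Q that
   contain [a]. A collision within one block contradicts zero-sum freeness. *)
pose f j := if j < mass P1 then wsum w (W j) else wsum w (V (j - mass P1)).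
have [|i [j [ij jL]]] := @pigeonhole_mod f R (mass U) R0; first by lia.
rewrite /f; have [jP1|P1j] := ltnP j (mass P1).
  rewrite (ltn_trans ij jP1) => e.
  have WjP : subm (W j) P by move=> b; apply: leq_trans (WP1 j b) (P1P b).
  have := zsfree_eqmod zP (Wmono _ _ (ltnW ij)) WjP e; rewrite !Wm; lia.
have [iP1|P1i] := ltnP i (mass P1); last first.
  move=> e; have le : i - mass P1 <= j - mass P1 by lia.
  have := zsfree_eqmod zQ (Vmono _ _ le) (VQ _) e; rewrite !Vm; lia.
set Wi := W i; set Vj := V _ => e.
have [b bW] : exists b, Wi b < P1 b by apply: mass_lt_ex; rewrite Wm; lia.
pose Q2 c := (Q c - Vj c) + Wi c.
have eQ2 : wsum w Q2 = x %[mod R].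
  by rewrite /Q2 wsumD -modnDmr e modnDmr -(wsumB w (VQ _)).
have [Q3 [Q32 zQ3 eQ3]] := zsfree_reduce R w Q2.
have {eQ3} eQ3x : wsum w Q3 = x %[mod R] by rewrite eQ3.
have bnd c : [/\ Q3 c <= (Q c - Vj c) + Wi c, Wi c <= P1 c, Vj c <= Q c,
    (c == a : nat) <= Vj c & P1 c = P c - Q c].
  by split; [exact: Q32|exact: WP1|exact: VQ|exact: Va|].
(* [Q3] replaces [Q] or [P] according to the bound it violates; the union loses a copy of [a] in the
   first case, of [b] in the second. *)
have [xQ3|yQ3] := nogood _ eQ3x.
- apply: (IH P Q3) => //; apply: leq_trans (_ : mass U <= n); last by rewrite -ltnS.
  apply: (mass_lt (a := a)) => [c|]; rewrite /U; [case: (bnd c)|case: (bnd a)].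
    by move: (P c) (Q c) (Q3 c) (Wi c) (Vj c) (P1 c) => p q q3 v u p1; clear; lia.
  move: aPQ; rewrite eqxx.
  by move: (P a) (Q a) (Q3 a) (Wi a) (Vj a) (P1 a) => p q q3 v u p1; clear; lia.
- apply: (IH Q3 Q) => //; apply: leq_trans (_ : mass U <= n); last by rewrite -ltnS.
  apply: (mass_lt (a := b)) => [c|]; rewrite /U; [case: (bnd c)|move: bW; case: (bnd b)].
    by move: (P c) (Q c) (Q3 c) (Wi c) (Vj c) (P1 c) => p q q3 v u p1; clear; lia.
  by move: (P b) (Q b) (Q3 b) (Wi b) (Vj b) (P1 b) => p q q3 v u p1; clear; lia.
Qed.

(** Otherwise the zero-sum free reductions of [A] and [B] form a pair excluded by [no_bad_pair]:
    each inherits one bound, so it violates the other. *)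
Lemma sumset_structure (I : finType) (R : nat) (w : I -> nat) (x y m : nat)
    (A B : I -> nat) :
  0 < R -> (forall i, w i <= R) -> R <= m.+1 -> x + y = m * R ->
  wsum w A = x %[mod R] -> wsum w A <= x ->
  wsum w B = x %[mod R] -> wsum (fun i => R - w i) B <= y ->
  exists P, [/\ wsum w P = x %[mod R], wsum w P <= x &
                wsum (fun i => R - w i) P <= y].
Proof.
move=> R0 wR Rm xy eA Ax eB By; apply: contrapT => nogood.
have {nogood} bad T : wsum w T = x %[mod R] ->
    (x < wsum w T) \/ (y < wsum (fun i => R - w i) T).
  move=> eT; have [//|Tx] := ltnP x (wsum w T); first by left.
  by right; rewrite ltnNge; apply/negP => Ty; apply: nogood; exists T.
have [A' [AA' zA eA']] := zsfree_reduce R w A.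
have [B' [BB' zB eB']] := zsfree_reduce R w B.
rewrite eA in eA'; rewrite eB in eB'.
have A'x := leq_trans (wsum_le w AA') Ax.
have B'y := leq_trans (wsum_le (fun i => R - w i) BB') By.
by apply: (@no_bad_pair I R w x y m A' B') => //;
  [have [] := bad _ eA'|have [] := bad _ eB'];
  lia.
Qed.

(** * Representations by generators and their length *)

Definition rep (I : finType) (w : I -> nat) (N x : nat) : Prop :=
  exists P, wsum w P = x /\ mass P <= N.

Definition representable (I : finType) (w : I -> nat) (x : nat) : Prop :=
  exists N, rep w N x.

(* The value is 0 when x is not representable. *)
Definition len (I : finType) (w : I -> nat) (x : nat) : nat :=
  if pselect (exists N, `[< rep w N x >]) is left e then ex_minn e else 0.

Lemma lenP (I : finType) (w : I -> nat) N x :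
  rep w N x -> rep w (len w x) x /\ len w x <= N.
Proof.
move=> wNx; rewrite /len; case: pselect => [e|[]]; last by exists N; apply/asboolP.
by case: ex_minnP => m /asboolP wmx mmin; split=> //; apply/mmin/asboolP.
Qed.

Lemma rep_widen (I : finType) (w : I -> nat) N N' x :
  N <= N' -> rep w N x -> rep w N' x.
Proof. by move=> NN' [P [<- PN]]; exists P; split=> //; apply: leq_trans NN'. Qed.

Lemma rep0 (I : finType) (w : I -> nat) : rep w 0 0.
Proof. by exists (fun=> 0); rewrite !wsum0. Qed.

Lemma repD (I : finType) (w : I -> nat) N N' x x' :
  rep w N x -> rep w N' x' -> rep w (N + N') (x + x').
Proof.
move=> [P [<- PN]] [P' [<- PN']]; exists (fun i => P i + P' i).
by rewrite !wsumD leq_add.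
Qed.

Lemma representableD (I : finType) (w : I -> nat) x x' :
  representable w x -> representable w x' -> representable w (x + x').
Proof. by move=> [N xN] [N' xN']; exists (N + N'); apply: repD. Qed.

Lemma repM (I : finType) (w : I -> nat) t i : rep w t (t * w i).
Proof.
exists (fun j => t * (j == i)); rewrite !wsumMl !wsum1; split=> //.
by rewrite muln1.
Qed.

Lemma rep_ub (I : finType) (w : I -> nat) R N x :
  (forall i, w i <= R) -> rep w N x -> x <= N * R.
Proof.
move=> wR [P [<- PN]]; apply: leq_trans (_ : mass P * R <= _).
  by rewrite -(wsum_compl P wR) leq_addr.
by rewrite leq_mul2r PN orbT.
Qed.

Lemma rep_dvd (I : finType) (w : I -> nat) d x :
  (forall i, d %| w i) -> representable w x -> d %| x.
Proof. by move=> dw [_ [P [<- _]]]; apply: dvdn_sum => i _; apply: dvdn_mull. Qed.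

(** * Length under addition of the largest generator *)

Lemma eqmod_addM (R a b : nat) : a = b %[mod R] -> a <= b ->
  exists t, b = a + t * R.
Proof.
move=> e ab; have /dvdnP[t bt] : R %| b - a by rewrite -eqn_mod_dvd //; apply/eqP.
by exists t; rewrite -bt subnKC.
Qed.

(** A zero-sum free reduction of [P] has at most [(w i0).-1] elements and, under either alternative,
    sum at most [x]; copies of [i0] make up the rest. *)
Lemma rep_residue (I : finType) (w P : I -> nat) (i0 : I) x :
  0 < w i0 -> (forall i, w i <= w i0) -> wsum w P = x %[mod w i0] ->
  wsum w P <= x \/ (w i0).-1 * w i0 <= x ->
  exists2 N, rep w N x & N * w i0 <= x + (w i0).-1 * w i0.
Proof.
set R := w i0 => R0 wR ePx Px.
have [Q [QP zQ eQ]] := zsfree_reduce R w P.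
have mQ : mass Q <= R.-1 by have := zsfree_mass R0 zQ; lia.
have mQR : mass Q * R <= R.-1 * R by rewrite leq_mul2r mQ orbT.
have Qx : wsum w Q <= x.
  case: Px => Px; first exact: leq_trans (wsum_le w QP) Px.
  apply: leq_trans Px; apply: leq_trans mQR.
  by rewrite -(wsum_compl Q wR) leq_addr.
rewrite ePx in eQ; have [t ->] := eqmod_addM eQ Qx.
exists (mass Q + t); first by apply: repD; [exists Q|exact: repM].
by rewrite mulnDl addnAC leq_add2r; apply: leq_trans mQR (leq_addl _ _).
Qed.

Lemma len_ub (I : finType) (w : I -> nat) (i0 : I) x :
  0 < w i0 -> (forall i, w i <= w i0) -> representable w x ->
  len w x * w i0 <= x + (w i0).-1 * w i0.
Proof.
move=> R0 wR [_ [P [Px _]]].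
have [||N wNx] := @rep_residue I w P i0 x R0 wR; first by rewrite Px.
  by left; rewrite Px.
by apply: leq_trans; rewrite leq_mul2r; have [_ ->] := lenP wNx; rewrite orbT.
Qed.

(** The representation of [x'] has complement sum at most N' R - x' <= m R - x, so the structure
    theorem applies. The multiset [P] it gives is completed to [x] by copies of [i0], and its
    complement bound limits the total to [m] elements. *)
Lemma rep_structure (I : finType) (w : I -> nat) (i0 : I) (x x' N N' m : nat) :
  0 < w i0 -> (forall i, w i <= w i0) -> w i0 <= m.+1 -> x <= m * w i0 ->
  rep w N x -> rep w N' x' -> x' = x %[mod w i0] ->
  N' * w i0 + x <= x' + m * w i0 -> rep w m x.
Proof.
set R := w i0 => R0 wR Rm xm [A [Ax _]] [B [Bx BN]] e le.
have DB : wsum (fun i => R - w i) B <= m * R - x.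
  have BNR : mass B * R <= N' * R by rewrite leq_mul2r BN orbT.
  by have := wsum_compl B wR; rewrite Bx; lia.
have [|||||P [eP Px DP]] := @sumset_structure I R w x (m * R - x) m A B R0 wR Rm.
- by rewrite subnKC.
- by rewrite Ax.
- by rewrite Ax.
- by rewrite Bx.
- exact: DB.
have [t xt] := eqmod_addM eP Px; have DPm := wsum_compl P wR.
apply: (@rep_widen _ _ (mass P + t)).
  by rewrite -(leq_pmul2r R0) mulnDl; lia.
by rewrite xt; apply: repD; [exists P|exact: repM].
Qed.

(** If [x + w i0] needed no more elements than [x], then [rep_structure] with m = len x - 1 would
    shorten the representation of [x]. The hypothesis on [len w x] is the condition R <= m + 1. *)
Lemma lenD_top (I : finType) (w : I -> nat) (i0 : I) x :
  0 < w i0 -> (forall i, w i <= w i0) -> representable w x ->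
  w i0 <= len w x -> len w (x + w i0) = len w x + 1.
Proof.
set R := w i0 => R0 wR [N0 wN0x] Rl.
have [wx _] := lenP wN0x.
have w1 : rep w 1 R by have := repM w 1 i0; rewrite mul1n.
have [wxR le] := lenP (repD wx w1).
apply/eqP; rewrite eqn_leq le /= addn1 ltnNge; apply/negP => ge.
have xR := rep_ub wR wxR.
have lR : len w (x + R) * R <= len w x * R by rewrite leq_mul2r ge orbT.
have lS : len w x * R = (len w x).-1 * R + R.
  by rewrite -[in LHS](prednK (leq_trans R0 Rl)) mulSn addnC.
have wp : rep w (len w x).-1 x.
  apply: (rep_structure R0 wR _ _ wx wxR); rewrite -/R ?modnDr //; lia.
have [_] := lenP wp; lia.
Qed.

Lemma lenD_topM (I : finType) (w : I -> nat) (i0 : I) x t :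
  0 < w i0 -> (forall i, w i <= w i0) -> representable w x ->
  w i0 <= len w x -> len w (x + t * w i0) = len w x + t.
Proof.
move=> R0 wR wx Rl; elim: t => [|t IH]; first by rewrite mul0n !addn0.
have wxt : representable w (x + t * w i0).
  by apply: representableD => //; exists t; apply: repM.
by rewrite mulSnr addnA lenD_top // IH -?addnA ?addn1 // (leq_trans Rl) ?leq_addr.
Qed.

(** * Large multiples of the gcd are representable *)

(** Residues of sums are closed under addition, hence under subtraction, the factor [R.-1] acting as
    -1; Bezout then yields the gcd. *)
Lemma dvdn_residue (I : finType) (w : I -> nat) (i0 : I) x :
  0 < w i0 -> \big[gcdn/0]_i w i %| x -> exists P, wsum w P = x %[mod w i0].
Proof.
set R := w i0 => R0.
pose T y := exists P, wsum w P = y %[mod R].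
have TD y z : T y -> T z -> T (y + z).
  move=> [P eP] [Q eQ]; exists (fun i => P i + Q i).
  by rewrite wsumD -modnDm eP eQ modnDm.
have TM c y : T y -> T (c * y).
  by move=> [P eP]; exists (fun i => c * P i); rewrite wsumMl -modnMmr eP modnMmr.
have Tg : T (\big[gcdn/0]_i w i).
  apply: (big_ind T) => [|y z Ty Tz|i _].
  - by exists (fun=> 0); rewrite wsum0.
  - have [->|y0] := posnP y; first by rewrite gcd0n.
    have [a _ /dvdnP[b e]] := Bezoutl z y0.
    have [P eP] := TD _ _ (TM b _ Ty) (TM (R.-1 * a) _ Tz).
    exists P; rewrite eP -e -addnA -(mulnA R.-1) -mulSn prednK //.
    by rewrite mulnC addnC modnMDl.
  - by exists (fun j => (j == i : nat)); rewrite wsum1.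
by move=> /dvdnP[c ->]; apply: TM.
Qed.

Lemma representable_large (I : finType) (w : I -> nat) (i0 : I) x :
  0 < w i0 -> (forall i, w i <= w i0) -> \big[gcdn/0]_i w i %| x ->
  (w i0).-1 * w i0 <= x -> representable w x.
Proof.
move=> R0 wR dx Rx; have [P eP] := dvdn_residue R0 dx.
by have [|N wNx _] := rep_residue R0 wR eP; [right|exists N].
Qed.

(** * The Frobenius number of M_n as a maximum *)

Lemma shifted_monoidP k r n X :
  shifted_monoid k r n X <->
  exists N x, rep (fun i : 'I_k => r i.+1) N x /\ X = N * n + x.
Proof.
set w := fun i : 'I_k => r i.+1; split.
  pose T : set nat := fun X => exists N x, rep w N x /\ X = N * n + x.
  move/(_ T); apply; split=> [|g /=].
    split=> [|X1 X2 [N1 [x1 [r1 ->]]] [N2 [x2 [r2 ->]]]].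
      by exists 0, 0; split; first exact: rep0.
    exists (N1 + N2), (x1 + x2); split; first exact: repD.
    by rewrite mulnDl addnACA.
  rewrite inE => /orP[/eqP->|/mapP[i]].
    by exists 1, 0; rewrite mul1n addn0; split=> //; apply: rep_widen (rep0 w).
  rewrite mem_iota => /andP[i1 ik] ->; have ik' : i.-1 < k by lia.
  exists 1, (w (Ordinal ik')); rewrite mul1n /w /= prednK //; split=> //.
  by have := repM w 1 (Ordinal ik'); rewrite mul1n /w /= prednK.
move=> [N [x [[P [<- PN]] ->]]] M [sM gM].
have gen g : g \in shifted_gens k r n -> M g by exact: gM.
have [M0 MD] := sM.
have -> : N * n + wsum w P = (N - mass P) * n + \sum_i P i * (n + w i).
  rewrite -[in LHS](subnK PN) mulnDl -addnA; congr addn.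
  rewrite big_distrl -big_split; apply: eq_bigr => i _ /=.
  by rewrite muln1 mulnDr.
apply: (MD); first by apply: submonoidM => //; apply: gen; rewrite mem_head.
apply: (big_ind M M0 MD) => i _; apply: submonoidM => //; apply: gen.
by rewrite inE; apply/orP; right; apply: map_f; rewrite mem_iota add1n !ltnS ltn_ord.
Qed.

(* The elements [base n + u] of the Apery set of S with respect to d n, where
   [base n] = d n - R; the condition says [u < R] or [u - R] is a gap of S. *)
Definition window (I : finType) (w : I -> nat) (i0 : I) (u : nat) : Prop :=
  \big[gcdn/0]_i w i %| u /\ ~ (w i0 <= u /\ representable w (u - w i0)).

Definition base (I : finType) (w : I -> nat) (i0 : I) (n : nat) : nat :=
  (\big[gcdn/0]_i w i) * n - w i0.

(** For [u] in the window and n > R^2 coprime to d, an element of the Apery set of M_n with respect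
    to n. *)
Definition apery_val (I : finType) (w : I -> nat) (i0 : I) (n u : nat) : nat :=
  len w (base w i0 n + u) * n + (base w i0 n + u).

Lemma dvdn_biggcd (I : finType) (w : I -> nat) i : \big[gcdn/0]_i w i %| w i.
Proof. by rewrite (bigD1 i) //= dvdn_gcdl. Qed.

Lemma biggcd_gt0 (I : finType) (w : I -> nat) i0 :
  0 < w i0 -> 0 < \big[gcdn/0]_i w i.
Proof. by move=> w0; apply: dvdn_gt0 w0 (dvdn_biggcd w i0). Qed.

(** Puts [base] in the range of [representable_large] and shows that its subtraction does not
    truncate. *)
Lemma base_large (I : finType) (w : I -> nat) (i0 : I) n :
  0 < w i0 -> w i0 ^ 2 < n ->
  (w i0).-1 * w i0 < base w i0 n /\
  (\big[gcdn/0]_i w i) * n = base w i0 n + w i0.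
Proof.
rewrite /base; set d := \big[gcdn/0]_i w i; set R := w i0 => R0 Rn.
have d0 : 0 < d by apply: (biggcd_gt0 (i0 := i0)).
have ndn : n <= d * n by rewrite leq_pmull.
have : R ^ 2 = R.-1 * R + R.
  by rewrite -mulnn -[in LHS](prednK R0) mulSn (prednK R0) addnC.
by move=> e; split; lia.
Qed.

Lemma dvdn_base (I : finType) (w : I -> nat) (i0 : I) n :
  \big[gcdn/0]_i w i %| base w i0 n.
Proof. by rewrite dvdn_sub ?dvdn_mulr ?dvdn_biggcd. Qed.

(** Beyond R^2, [u - w i0] is a multiple of d large enough to be representable. The window is thus
    finite, uniformly in n. *)
Lemma window_bound (I : finType) (w : I -> nat) (i0 : I) u :
  0 < w i0 -> (forall i, w i <= w i0) -> window w i0 u -> u <= w i0 ^ 2.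
Proof.
move=> R0 wR [du nu]; rewrite leqNgt; apply/negP => Ru; apply: nu.
have : w i0 ^ 2 = (w i0).-1 * w i0 + w i0.
  by rewrite -mulnn -[in LHS](prednK R0) mulSn (prednK R0) addnC.
move=> e; split; first lia.
apply: (@representable_large I w i0) => //; last lia.
by rewrite dvdn_sub ?dvdn_biggcd.
Qed.

(** A sum above (R - 1) R needs at least R generators, as [lenD_topM] requires. *)
Lemma len_base (I : finType) (w : I -> nat) (i0 : I) n u :
  0 < w i0 -> (forall i, w i <= w i0) -> w i0 ^ 2 < n ->
  \big[gcdn/0]_i w i %| u ->
  representable w (base w i0 n + u) /\ w i0 <= len w (base w i0 n + u).
Proof.
move=> R0 wR Rn du; have [Rb _] := base_large R0 Rn.
have wz : representable w (base w i0 n + u).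
  apply: (@representable_large I w i0) => //; last by lia.
  by rewrite dvdn_add ?dvdn_base.
split=> //; case: wz => N /lenP[/(rep_ub wR) le _].
rewrite -(prednK R0) -(ltn_pmul2r R0); lia.
Qed.

Lemma apery_val_frobenius k (r : nat -> nat) (i0 : 'I_k) n u :
  let w := fun i : 'I_k => r i.+1 in
  0 < w i0 -> (forall i, w i <= w i0) -> w i0 ^ 2 < n ->
  coprime n (\big[gcdn/0]_i w i) -> window w i0 u ->
  (forall v, window w i0 v -> apery_val w i0 n v <= apery_val w i0 n u) ->
  is_frobenius (shifted_monoid k r n) (apery_val w i0 n u - n).
Proof.
move=> w R0 wR Rn; set d := \big[gcdn/0]_i w i => ncop [du nu] umax.
have d0 : 0 < d by apply: (biggcd_gt0 (i0 := i0)).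
have dR : d %| w i0 by apply: dvdn_biggcd.
have [Rb dnE] := base_large R0 Rn.
set R := w i0 in R0 wR Rn nu Rb dnE dR.
have n0 : 0 < n by apply: leq_ltn_trans Rn.
have RR : R ^ 2 = R.-1 * R + R.
  by rewrite -mulnn -[in LHS](prednK R0) mulSn (prednK R0) addnC.
have wlarge x : d %| x -> R.-1 * R <= x -> representable w x.
  exact: representable_large.
have [wz Rlz] := len_base R0 wR Rn du.
split.
  move=> /shifted_monoidP[N [x [wNx]]].
  set z := base w i0 n + u in wz Rlz.
  have nV : n <= len w z * n by rewrite leq_pmull // (leq_trans R0).
  rewrite /apery_val -/z => e.
  have {e} e : N.+1 * n + x = len w z * n + z by rewrite mulSn; lia.
  have dx : d %| x by apply: (rep_dvd (dvdn_biggcd w)); exists N.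
  have dz : d %| z by rewrite dvdn_add ?dvdn_base.
  have xz : x = z %[mod d * n].
    apply/eqP; rewrite chinese_remainder 1?coprime_sym //.
    rewrite /dvdn in dx dz; rewrite (eqP dx) (eqP dz) eqxx /=.
    by rewrite -(modnMDl N.+1) e modnMDl.
  (* If x < z, then z - d n is representable, against the window condition. If x > z, then x >= z +
     d n forces [len w z] above its upper bound. If x = z, then len z = N + 1 is not minimal. *)
  have [xz'|zx|xz'] := ltngtP x z.
  - have [t zt] := eqmod_addM xz (ltnW xz').
    clear xz; have t0 : 0 < t.
      by case: t zt => // zx; rewrite zx mul0n addn0 ltnn in xz'.
    have dnt : t * (d * n) = t.-1 * (d * n) + d * n.
      by rewrite -[in LHS](prednK t0) mulSn addnC.
    apply: nu; have uE : u = R + (x + t.-1 * (d * n)) by lia.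
    split; first by rewrite uE leq_addr.
    rewrite uE addKn; apply: representableD; first by exists N.
    have [->|t1] := posnP t.-1; first by exists 0; apply: rep0.
    apply: wlarge; first by rewrite dvdn_mull ?dvdn_mulr.
    have := leq_pmull (d * n) t1; lia.
  - have zdx := eqmod_lt (esym xz) zx; clear xz.
    have lzR := len_ub R0 wR wz.
    have xN := rep_ub wR wNx.
    have : (N.+1 + d) * n <= len w z * n by rewrite mulnDl; lia.
    rewrite leq_pmul2r // => le.
    have : (N.+1 + d) * R <= len w z * R by rewrite leq_mul2r le orbT.
    rewrite mulnDl mulSn -/R in lzR *; lia.
  - have [_ lN] := lenP wNx; clear xz.
    move: e lN; rewrite xz' => /addIn /eqP; rewrite eqn_pmul2r // => /eqP <-.
    by rewrite ltnn.
move=> X nX; rewrite leqNgt; apply/negP => ltX; apply: nX.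
have cdn : coprime d n by rewrite coprime_sym.
pose z0 := chinese d n 0 X %% (d * n).
have z0X : z0 = X %[mod n] by rewrite /z0 modn_dvdm ?dvdn_mull // chinese_modr.
have dz0 : d %| z0.
  rewrite /dvdn /z0 modn_dvdm ?dvdn_mulr //; have := chinese_modl cdn 0 X.
  by rewrite mod0n => ->.
have z0dn : z0 < d * n by rewrite ltn_mod muln_gt0 d0.
(* [q] is the least representable number congruent to X mod n: [z0], or [z0 + d * n] when [z0] is a
   gap. *)
have [q [wq dq qX qz0]] : exists q, [/\ representable w q, d %| q,
    q = X %[mod n] & q < d * n \/ (q = z0 + d * n /\ ~ representable w z0)].
  have [wz0|nwz0] := pselect (representable w z0).
    by exists z0; split=> //; left.
  exists (z0 + d * n); split=> //; last by right.
  - apply: wlarge; rewrite ?dvdn_add ?dvdn_mulr // dnE addnA.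
    by apply: leq_trans (leq_addr _ _); apply: leq_trans (leq_addl _ _); apply: ltnW.
  - by rewrite dvdn_add ?dvdn_mulr.
  - by rewrite -modnDmr modnMl addn0.
suff qV : len w q * n + q <= apery_val w i0 n u.
  have eX : len w q * n + q = X %[mod n] by rewrite modnMDl.
  have qleX : len w q * n + q <= X.
    rewrite leqNgt; apply/negP => /(eqmod_lt (esym eX)).
    by clear -ltX qV; lia.
  have [t ->] := eqmod_addM eX qleX.
  have [N wNq] := wq; have [wl _] := lenP wNq.
  apply/shifted_monoidP; exists (len w q + t), q; split.
    exact: rep_widen (leq_addr _ _) wl.
  by rewrite mulnDl addnAC.
have [bq|qb] := leqP (base w i0 n) q.
  have qE : q = base w i0 n + (q - base w i0 n) by rewrite subnKC.
  rewrite [in X in X <= _]qE; apply: umax; split.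
    by rewrite dvdn_sub ?dvdn_base.
  rewrite -/R => -[Rq]; case: qz0 => [|[qz0 nwz0]].
    by clear -Rq dnE bq; lia.
  by rewrite qz0 dnE -subnDA addnK.
(* A short [q] below [base] is dominated by any window element, whose length is at least R; [R - d]
   is one. *)
have [lqR|Rlq] := leqP (len w q) R.
  have dv : d %| R - d by rewrite dvdn_sub.
  have Wv : window w i0 (R - d).
    split=> // -[]; rewrite -/R; have := dvdn_leq R0 dR.
    by clear -R0 d0; lia.
  apply: leq_trans (umax _ Wv); have [_ Rl] := len_base R0 wR Rn dv.
  apply: leq_add; last by apply: leq_trans (ltnW qb) (leq_addr _ _).
  by rewrite leq_mul2r (leq_trans lqR Rl) orbT.
(* A long [q] is moved by the largest t with q + t R < d n, which lands in the window and increases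
   the length by t. *)
pose t := (d * n - 1 - q) %/ R.
have tlo : t * R <= d * n - 1 - q by apply: leq_divM.
have thi : d * n - 1 - q < t * R + R by rewrite addnC -mulSn; apply: ltn_ceil.
pose v := q + t * R - base w i0 n.
have [btR tRd] : base w i0 n <= q + t * R /\ q + t * R < d * n.
  case: qz0 => [qdn|[]]; last by clear -qb dnE R0; lia.
  by split; clear -tlo thi qdn dnE R0; lia.
have qv : base w i0 n + v = q + t * R by rewrite subnKC.
have Wv : window w i0 v.
  split; last by rewrite -/R /v; clear -tRd btR dnE; lia.
  by rewrite dvdn_sub ?dvdn_base ?dvdn_add ?dvdn_mull.
apply: leq_trans (umax _ Wv); rewrite /apery_val qv.
rewrite (lenD_topM t R0 wR wq (ltnW Rlq)) -/R.
by apply: leq_add; rewrite ?leq_mul2r leq_addr ?orbT.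
Qed.

(** * Dependence on n along a residue class mod r_k *)

Lemma baseD (I : finType) (w : I -> nat) (i0 : I) n t :
  0 < w i0 -> w i0 ^ 2 < n ->
  base w i0 (n + t * w i0) = base w i0 n + t * (\big[gcdn/0]_i w i) * w i0.
Proof.
move=> R0 Rn; have [_ e] := base_large R0 Rn; rewrite {1}/base mulnDr e.
rewrite addnAC addnK; congr addn; ring.
Qed.

Lemma lenD_base (I : finType) (w : I -> nat) (i0 : I) n t u :
  0 < w i0 -> (forall i, w i <= w i0) -> w i0 ^ 2 < n ->
  \big[gcdn/0]_i w i %| u ->
  len w (base w i0 (n + t * w i0) + u) =
  len w (base w i0 n + u) + t * (\big[gcdn/0]_i w i).
Proof.
move=> R0 wR Rn du; have [wz Rl] := len_base R0 wR Rn du.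
by rewrite baseD // addnAC; apply: lenD_topM.
Qed.

(* The offsets u and v differ by less than n, so comparing the two values amounts
   to a lexicographic comparison that does not involve n. *)
Lemma apery_val_max_shift (I : finType) (w : I -> nat) (i0 : I) n t u :
  0 < w i0 -> (forall i, w i <= w i0) -> w i0 ^ 2 < n -> window w i0 u ->
  (forall v, window w i0 v -> apery_val w i0 n v <= apery_val w i0 n u) ->
  forall v, window w i0 v ->
    apery_val w i0 (n + t * w i0) v <= apery_val w i0 (n + t * w i0) u.
Proof.
move=> R0 wR Rn Wu umax v Wv; have := umax v Wv; have uR := window_bound R0 wR Wu.
have [du _] := Wu; have [dv _] := Wv.
rewrite /apery_val !lenD_base // baseD //.
move: (len w (_ + v)) (len w (_ + u)) => a b; move: (base w i0 n) => c.
move=> le; have [ab|ba] := leqP a b.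
  have : a * (t * w i0) <= b * (t * w i0) by rewrite leq_mul2r ab orbT.
  by rewrite !mulnDl !mulnDr; clear -le; lia.
have : b.+1 * n <= a * n by rewrite leq_mul2r ba orbT.
by rewrite mulSn; clear -le uR Rn; lia.
Qed.

Lemma window_max_exists (I : finType) (w : I -> nat) (i0 : I) n :
  0 < w i0 -> (forall i, w i <= w i0) ->
  exists2 u, window w i0 u &
    forall v, window w i0 v -> apery_val w i0 n v <= apery_val w i0 n u.
Proof.
move=> R0 wR; pose M := (w i0 ^ 2).+1.
have W0 : window w i0 0 by split; [rewrite dvdn0|case; lia].
pose i : 'I_M := ord0.
case: (@arg_maxnP _ i (fun j : 'I_M => `[< window w i0 j >])
         (fun j : 'I_M => apery_val w i0 n j)) => [|u /asboolP Wu umax].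
  exact/asboolP.
exists u => // v Wv; have vM : v < M by rewrite ltnS; apply: window_bound Wv.
by apply: (umax (Ordinal vM)); apply/asboolP.
Qed.

Lemma frobenius_quadratic_on_class (R : realType) k (r : nat -> nat)
    (i0 : 'I_k) c :
  let w := fun i : 'I_k => r i.+1 in
  let d := \big[gcdn/0]_i w i in
  0 < w i0 -> (forall i, w i <= w i0) ->
  exists ab : R * R, forall n, w i0 ^ 2 < n -> n %% w i0 = c -> coprime n d ->
    ((frobenius (shifted_monoid k r n))%:R =
       d%:R / (w i0)%:R * n%:R ^+ 2 + ab.1 * n%:R + ab.2)%R.
Proof.
move=> w d R0 wR.
pose C n := [&& w i0 ^ 2 < n, n %% w i0 == c & coprime n d].
have [exC|noC] := pselect (exists n, C n); last first.
  (* A class without admissible n imposes no condition on the coefficients. *)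
  exists (0, 0)%R => n Rn nc nd; case: noC; exists n; rewrite /C Rn nd andbT.
  exact/eqP.
case: (ex_minnP exC) => n1 /and3P[Rn1 /eqP n1c n1d] n1min.
have [u Wu umax] := window_max_exists n1 R0 wR.
pose l := len w (base w i0 n1 + u).
(* Expansion of (l + t d) n + (d n - r_k + u) - n with t = (n - n1) / r_k; the maximizer [u] found
   at the least admissible [n1] serves the whole class. *)
exists (l%:R - d%:R * n1%:R / (w i0)%:R + d%:R - 1, u%:R - (w i0)%:R)%R.
move=> n Rn nc nd /=.
have n1n : n1 <= n by apply: n1min; rewrite /C Rn nd andbT; apply/eqP.
have nn1 : n1 = n %[mod w i0] by rewrite n1c nc.
have [t nE] := eqmod_addM nn1 n1n.
have tumax := apery_val_max_shift t R0 wR Rn1 Wu umax; rewrite -nE in tumax.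
have [du _] := Wu.
have [_ Rl] := len_base R0 wR Rn du.
have [_ bE] := base_large R0 Rn; rewrite -/d in bE.
rewrite (is_frobenius_eq (apery_val_frobenius R0 wR Rn nd Wu tumax)).
have lE : len w (base w i0 n + u) = l + t * d by rewrite nE lenD_base.
have nV : n <= apery_val w i0 n u.
  by apply: leq_trans (leq_addr _ _); rewrite leq_pmull // (leq_trans R0 Rl).
rewrite natrB // /apery_val lE !(natrD, natrM) nE.
have -> : ((base w i0 (n1 + t * w i0))%:R = d%:R * n%:R - (w i0)%:R :> R)%R.
  by rewrite -nE -natrM bE natrD addrK.
rewrite nE !(natrD, natrM).
have wn0 : ((w i0)%:R != 0 :> R)%R by rewrite pnatr_eq0 -lt0n.
by field.
Qed.

Theorem corollary4p3 (R : realType) (k : nat) (hk : (1 <= k)%N)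
    (r : nat -> nat) (hr1 : (0 < r 1)%N)
    (hr : forall i j : nat, (1 <= i)%N -> (i < j)%N -> (j <= k)%N -> (r i < r j)%N)
    (d : nat) (hd : d = \big[gcdn/0%N]_(1 <= i < k.+1) r i) :
  exists a0 a1 a2 : int -> R,
    [/\ periodic_dvd (r k) a0, periodic_dvd (r k) a1, periodic_dvd (r k) a2,
        exists x : int, coprimez x d%:Z /\ a2 x <> 0%R
      & forall n : nat, (r k ^ 2 < n)%N -> coprime n d ->
          ((frobenius (shifted_monoid k r n))%:R
            = a2 n%:Z * n%:R ^+ 2 + a1 n%:Z * n%:R + a0 n%:Z)%R].
Proof.
have k1 : k.-1 < k by rewrite prednK.
pose i0 : 'I_k := Ordinal k1.
have w0 : r i0.+1 = r k by rewrite /= prednK.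
have rk0 : 0 < r i0.+1.
  rewrite w0; have [k2|] := ltnP 1 k; first exact: leq_trans hr1 (ltnW (hr 1 k _ k2 _)).
  by move=> k1'; have -> : k = 1 by apply/eqP; rewrite eqn_leq k1'.
have rle (i : 'I_k) : r i.+1 <= r i0.+1.
  rewrite w0; have [->//|ik] := eqVneq i.+1 k.
  by apply/ltnW/hr => //; rewrite ltn_neqAle ik ltn_ord.
have dE : d = \big[gcdn/0]_(i < k) r i.+1 by rewrite hd big_add1 big_mkord.
have /choice[ab abP] := fun c => frobenius_quadratic_on_class R c rk0 rle.
rewrite -dE w0 in abP; rewrite w0 in rk0.
have per (g : nat -> R) : periodic_dvd (r k) (fun x : int => g `|(x %% r k)%Z|%N).
  by exists (r k); split=> // x; rewrite modzDr.
exists (fun x => (ab `|(x %% r k)%Z|%N).2), (fun x => (ab `|(x %% r k)%Z|%N).1).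
exists (fun=> d%:R / (r k)%:R)%R; split.
- exact: (per (fun c => (ab c).2)).
- exact: (per (fun c => (ab c).1)).
- exact: (per (fun=> (d%:R / (r k)%:R)%R)).
(* The leading coefficient is the nonzero constant d / r_k, so any integer coprime to d is a
   witness. *)
- exists 1%R; split; first by rewrite /coprimez gcd1z.
  apply/eqP; rewrite mulf_neq0 ?invr_eq0 // pnatr_eq0 -lt0n //.
  by rewrite dE; apply: (biggcd_gt0 (i0 := i0)); rewrite /= prednK.
- by move=> n Rn nd; rewrite modz_nat absz_nat; apply: abP.
Qed.
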